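(* Let $\mathbb{Z}^2$ denote the standard lattice graph with vertex weights $\mu\equiv 4$ and edge weights $w\equiv 1$. For every function $u:\mathbb{Z}^2\to\mathbb{R}$ satisfying $\Delta u(x)+e^{u(x)}=0$ for all $x\in\mathbb{Z}^2$, we have $$\int_{\mathbb{Z}^2}e^u\ \geq\ 4.$$
   Context: The lattice graph $\mathbb{Z}^2$ has vertex set $\{(x,y)\in\mathbb{R}^2: x,y\in\mathbb{Z}\}$ and edge set $\{\{(x_1,y_1),(x_2,y_2)\}: |x_1-x_2|+|y_1-y_2|=1\}$; $p\sim q$ means that $\{p,q\}$ is an edge. It carries vertex weights $\mu_p=4$ for every vertex $p$ and edge weights $w_{pq}=1$ for every edge $\{p,q\}$. The Laplacian of $u:\mathbb{Z}^2\to\mathbb{R}$ is $\Delta u(p)=\frac{1}{\mu_p}\sum_{q\sim p}w_{pq}(u(q)-u(p))=\frac14\sum_{q\sim p}(u(q)-u(p))$. The integral is taken with respect to $\mu$: $\int_{\mathbb{Z}^2}f=\sum_{p\in\mathbb{Z}^2}f(p)\mu_p=4\sum_{p\in\mathbb{Z}^2}f(p)$; for the positive function $e^u$ it takes values in $[0,+\infty]$ (the inequality is trivially true when it is $+\infty$). *)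

(* Defs.v *)
From HB Require Import structures.
From mathcomp Require Import all_boot all_order all_algebra.
From mathcomp Require Import all_classical all_reals all_analysis.
From mathcomp Require Import zify.

Set Implicit Arguments.
Unset Strict Implicit.
Unset Printing Implicit Defensive.

Import Order.TTheory GRing.Theory Num.Theory.

Local Open Scope classical_set_scope.
Local Open Scope ring_scope.

Definition lattice : Type := (int * int)%type.

Definition adjacent (p q : lattice) : bool :=
  `|p.1 - q.1| + `|p.2 - q.2| == 1 :> int.

Definition vertex_weight (R : realType) (p : lattice) : R := 4.

Definition edge_weight (R : realType) (p q : lattice) : R := 1.

(* The sum over neighbours is a finitely supported sum; it would default to 0
   if infinitely many terms were nonzero, which [finite_neighbors] excludes. *)
Definition laplacian (R : realType) (u : lattice -> R) (p : lattice) : R :=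
  (vertex_weight R p)^-1 *
  \sum_(q \in [set q | adjacent p q]) (edge_weight R p q * (u q - u p)).

(* Meaningful for nonnegative [f] only: [esum] is the supremum of the sums
   over finite subsets, with values in [0, +oo]. *)
Definition lattice_integral (R : realType) (f : lattice -> R) : \bar R :=
  \esum_(p in [set: lattice]) (f p * vertex_weight R p)%:E.

Lemma neighborsE (p : lattice) :
  [set q | adjacent p q] =
  [set` [:: (p.1 + 1, p.2); (p.1 - 1, p.2); (p.1, p.2 + 1); (p.1, p.2 - 1)]].
Proof.
case: p => x y; apply/seteqP; split => -[a b]; rewrite /adjacent /= !inE !xpair_eqE.
  by move=> /eqP h; lia.
by move=> /or4P h; apply/eqP; case: h => /andP[/eqP -> /eqP ->]; lia.
Qed.

Lemma finite_neighbors (p : lattice) : finite_set [set q | adjacent p q].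
Proof. by rewrite neighborsE; exact: finite_seq. Qed.

(* Main.v *)
(** Let [A] be the averaging operator over the four neighbours. The equation
    reads [A u = u - e^u], so [f_t := (A^t u)(0)] and [g_t := (A^t e^u)(0)]
    satisfy [f_(t+1) = f_t - g_t], while Jensen's inequality gives
    [e^(f_t) <= g_t]. In the coordinates [x + y], [x - y] the simple random walk
    on the lattice splits into two independent walks on the line, so its heat
    kernel is a product of two binomial weights and is at most [1 / t]. Hence
    [g_t <= S / t] with [S] the sum of [e^u]. If [S < 1], the recursion yields
    [f_t >= - S ln t - O(1)], whereas Jensen yields [f_t <= ln S - ln t], a
    contradiction for large [t]. *)
Require Import Defs.
From mathcomp Require Import all_boot all_order all_algebra.
From mathcomp Require Import all_classical all_reals all_analysis.
From mathcomp Require Import zify ring lra.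

Import Order.TTheory GRing.Theory Num.Theory.
Local Open Scope ring_scope.

Lemma bin_double_le_central (m i : nat) : ('C(m.*2, i) <= 'C(m.*2, m))%N.
Proof.
have below k : (k <= m)%N -> ('C(m.*2, m - k) <= 'C(m.*2, m))%N.
  elim: k => [|k IHk] km; first by rewrite subn0.
  apply: leq_trans (IHk (ltnW km)).
  have := mul_bin_left m.*2 (m - k.+1).
  by rewrite (_ : (m - k.+1).+1 = m - k)%N; [nia | lia].
have [im|mi] := leqP i m; first by rewrite -(subKn im) below ?leq_subr.
have [im2|im2] := leqP i m.*2; last by rewrite bin_small.
rewrite -bin_sub// (_ : m.*2 - i = m - (i - m))%N; last by lia.
by apply: below; lia.
Qed.

(** Induction through [C(2m+2, m+1) = 2(2m+1)/(m+1) C(2m, m)]. The factor [2m+1], unlike [2m], lets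
    it close, because [(2m+3)(2m+1) <= 4(m+1)^2]. *)
Lemma central_bin_sqr_le (m : nat) :
  (m.*2.+1 * 'C(m.*2, m) ^ 2 <= 4 ^ m.*2)%N.
Proof.
elim: m => [//|m IHm].
have step : (m.+1 * 'C(m.+1.*2, m.+1) = 2 * m.*2.+1 * 'C(m.*2, m))%N.
  have h1 := mul_bin_diag m.+1.*2 m.
  have h2 := mul_bin_down m.*2.+1 m.
  rewrite doubleS /= in h1 h2 *.
  by nia.
rewrite -(leq_pmul2l (_ : 0 < m.+1 ^ 2)%N) ?expn_gt0//.
rewrite [leqLHS](_ : _ = m.+1.*2.+1 * (m.+1 * 'C(m.+1.*2, m.+1)) ^ 2)%N; last first.
  by rewrite expnMn mulnCA.
rewrite step doubleS !expnS.
move: IHm; rewrite !expnS !expn0; set c := 'C(_, _); set e := (4 ^ _)%N.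
move=> IHm.
have h : (m.*2.+3 * m.*2.+1 <= 4 * (m.+1 * m.+1))%N by lia.
have := leq_mul h IHm.
by nia.
Qed.

(** The heat kernel bound [C(t, i) / 2^t <= 1 / sqrt t] on the line, squared so as to stay in
    [nat]. *)
Lemma bin_sqr_le (t i : nat) : (t * 'C(t, i) ^ 2 <= 4 ^ t)%N.
Proof.
have even_case m k : (m.*2.+1 * 'C(m.*2, k) ^ 2 <= 4 ^ m.*2)%N.
  apply: leq_trans (central_bin_sqr_le m).
  by rewrite leq_mul2l leq_exp2r// bin_double_le_central orbT.
rewrite -(odd_double_half t); case: (odd t); last first.
  by apply: leq_trans (even_case t./2 i); rewrite leq_mul2r leqnSn orbT.
rewrite add1n [(4 ^ _)%N]expnS; case: i => [|i].
  have := even_case t./2 0%N; rewrite !bin0 exp1n !muln1 => h.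
  by apply: leq_trans h _; rewrite leq_pmull.
(* Pascal's rule reduces the odd row to the preceding even one, and [(a + b)^2 <= 2 a^2 + 2 b^2]
   costs exactly the spare factor 4. *)
rewrite binS.
have := even_case t./2 i; have := even_case t./2 i.+1.
rewrite !expnS !expn0 !muln1.
set a := 'C(_, _); set b := 'C(_, _); set n := _.*2.+1.
by move=> ha hb; nia.
Qed.

(** By [2ab <= a^2 + b^2]; this is the [1 / t] bound for the planar kernel. *)
Lemma bin_mul_le (t i j : nat) : (t * ('C(t, i) * 'C(t, j)) <= 4 ^ t)%N.
Proof.
by have := bin_sqr_le t i; have := bin_sqr_le t j; rewrite !expnS !expn0 !muln1; nia.
Qed.

(** Pascal's rule summed against [G]: it peels one step off a walk on the line. *)
Lemma sum_binS (R : nzRingType) (t : nat) (G : nat -> R) :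
  \sum_(i < t.+2) 'C(t.+1, i)%:R * G i =
  \sum_(i < t.+1) 'C(t, i)%:R * (G i + G i.+1).
Proof.
under [RHS]eq_bigr do rewrite mulrDr.
rewrite big_split /= big_ord_recl /= bin0.
under eq_bigr do rewrite /bump /= add1n binS natrD mulrDl.
rewrite big_split /= addrA; congr (_ + _).
rewrite big_ord_recr /= bin_small// mul0r addr0.
by rewrite [RHS]big_ord_recl /= bin0.
Qed.

Section NeighborMean.
Context {R : realType}.
Implicit Types (u v : lattice -> R) (p : lattice) (t : nat).

Definition neighbor_mean v p : R :=
  4^-1 * (v (p.1 + 1, p.2) + v (p.1 - 1, p.2) +
          v (p.1, p.2 + 1) + v (p.1, p.2 - 1)).

Lemma laplacianE u p : laplacian u p = neighbor_mean u p - u p.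
Proof.
rewrite /laplacian neighborsE -fsbig_seq; last first.
  by case: p => x y /=; rewrite !inE !xpair_eqE; lia.
rewrite !big_cons big_nil /edge_weight /vertex_weight /neighbor_mean /=.
by field.
Qed.

Lemma neighbor_meanB u v p :
  neighbor_mean (fun q => u q - v q) p = neighbor_mean u p - neighbor_mean v p.
Proof. by rewrite /neighbor_mean; ring. Qed.

Lemma iter_neighbor_meanB u v t p :
  iter t neighbor_mean (fun q => u q - v q) p =
  iter t neighbor_mean u p - iter t neighbor_mean v p.
Proof.
elim: t p => [//|t IHt] p; rewrite !iterS -neighbor_meanB.
by congr (neighbor_mean _ p); apply/funext => q; exact: IHt.
Qed.

Lemma neighbor_mean_le u v p :
  (forall q, u q <= v q) -> neighbor_mean u p <= neighbor_mean v p.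
Proof. by move=> uv; rewrite ler_pM2l ?invr_gt0// !lerD. Qed.

(* Jensen: average the tangent inequality [e^m (1 + x - m) <= e^x] at the
   mean [m]. *)
Lemma expR_neighbor_mean_le u p :
  expR (neighbor_mean u p) <= neighbor_mean (fun q => expR (u q)) p.
Proof.
have tangent (m x : R) : expR m * (1 + (x - m)) <= expR x.
  by rewrite -[in leRHS](subrK m x) expRD mulrC ler_pM2r ?expR_gt0 ?expR_ge1Dx.
set m := neighbor_mean u p.
have -> : expR m = neighbor_mean (fun q => expR m * (1 + (u q - m))) p.
  transitivity (expR m * (1 + (neighbor_mean u p - m))).
    by rewrite -/m subrr addr0 mulr1.
  by rewrite /neighbor_mean; field.
by apply: neighbor_mean_le => q; exact: tangent.
Qed.

Lemma expR_iter_neighbor_mean_le u t p :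
  expR (iter t neighbor_mean u p) <=
  iter t neighbor_mean (fun q => expR (u q)) p.
Proof.
elim: t p => [//|t IHt] p; rewrite !iterS.
by apply: le_trans (expR_neighbor_mean_le _ _) _; exact: neighbor_mean_le.
Qed.

(** Position after [t] steps from [p] when [x + y] has gone up [i] times and [x - y] has gone up [j]
    times. *)
Definition diagonal_point t p (i j : nat) : lattice :=
  (p.1 + i%:Z + j%:Z - t%:Z, p.2 + i%:Z - j%:Z).

Lemma iter_neighbor_mean_bin v t p :
  iter t neighbor_mean v p = (4 ^+ t)^-1 *
  \sum_(i < t.+1) 'C(t, i)%:R *
    \sum_(j < t.+1) 'C(t, j)%:R * v (diagonal_point t p i j).
Proof.
elim: t v => [|t IHt] v.
  rewrite expr0 invr1 !big_ord1 /= bin0 !mul1r; congr v.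
  by case: p => x y; rewrite /diagonal_point /=; congr pair; lia.
rewrite iterSr IHt exprS invfM [4^-1 * _]mulrC -mulrA; congr (_ * _).
rewrite (sum_binS _ _ (fun i => \sum_(j < t.+2)
  'C(t.+1, j)%:R * v (diagonal_point t.+1 p i j))) mulr_sumr.
apply: eq_bigr => i _; rewrite mulrCA; congr (_ * _).
rewrite !(sum_binS _ _ (fun j => v (diagonal_point t.+1 p _ j))).
rewrite -big_split /= mulr_sumr; apply: eq_bigr => j _.
rewrite -mulrDr mulrCA; congr (_ * (_ * _)).
(* The four neighbours are the four ways of raising or not raising each of [i] and [j] in step
   [t + 1]. *)
rewrite /diagonal_point /=.
rewrite (_ : (_ + 1, _) = (p.1 + i.+1%:Z + j.+1%:Z - t.+1%:Z,
  p.2 + i.+1%:Z - j.+1%:Z)); last by congr pair; lia.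
rewrite (_ : (_ - 1, _) = (p.1 + i%:Z + j%:Z - t.+1%:Z,
  p.2 + i%:Z - j%:Z)); last by congr pair; lia.
rewrite (_ : (_, _ + 1) = (p.1 + i.+1%:Z + j%:Z - t.+1%:Z,
  p.2 + i.+1%:Z - j%:Z)); last by congr pair; lia.
rewrite (_ : (_, _ - 1) = (p.1 + i%:Z + j.+1%:Z - t.+1%:Z,
  p.2 + i%:Z - j.+1%:Z)); last by congr pair; lia.
by ring.
Qed.

Lemma iter_neighbor_mean_le_sum v t p (S : R) : (forall q, 0 <= v q) ->
  (forall s : seq lattice, uniq s -> \sum_(q <- s) v q <= S) ->
  iter t.+1 neighbor_mean v p <= S / t.+1%:R.
Proof.
move=> v0 vS; rewrite iter_neighbor_mean_bin.
set T := t.+1; pose I := index_enum 'I_T.+1.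
pose s := [seq diagonal_point T p (i : 'I_T.+1) (j : 'I_T.+1) | i <- I, j <- I].
(* [i + j] and [i - j] determine [i] and [j], so no lattice point is counted twice. *)
have us : uniq s.
  apply: allpairs_uniq; rewrite ?index_enum_uniq// => -[i j] [k l] _ _ /=.
  by case=> h1 h2; congr pair; apply: val_inj => /=; lia.
rewrite ler_pdivlMr ?ltr0n// mulrC mulrA.
apply: le_trans (vS s us); rewrite big_allpairs_dep /=.
rewrite mulr_sumr; apply: ler_sum => i _.
rewrite mulr_sumr mulr_sumr; apply: ler_sum => j _.
rewrite !mulrA ler_piMl// -!mulrA mulrCA ler_pdivrMl ?exprn_gt0// mulr1.
by rewrite -!natrM -natrX ler_nat bin_mul_le.
Qed.

End NeighborMean.

Lemma ge1_of_harmonic_decay (R : realType) (S : R) (f : nat -> R) :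
  (forall t : nat, f t.+1 - S / t.+1%:R <= f t.+2) ->
  (forall t : nat, expR (f t.+1) <= S / t.+1%:R) -> 1 <= S.
Proof.
move=> fdec fexp.
have S0 : 0 < S.
  by have := lt_le_trans (expR_gt0 _) (fexp 0%N); rewrite divr1.
(* Starting from [f 2] keeps the logarithm away from 0. *)
have lower t : f 2%N - S * ln t.+1%:R <= f t.+2.
  elim: t => [|t IHt]; first by rewrite ln1 mulr0 subr0.
  apply: le_trans (fdec t.+1).
  have posS : 0 < t.+2%:R :> R by rewrite ltr0n.
  have step : t.+2%:R^-1 <= ln t.+2%:R - ln t.+1%:R :> R.
    (* [ln (1 - x) <= - x] at [x = 1 / (t + 2)]. *)
    have := @le_ln1Dx R (- t.+2%:R^-1).
    rewrite ltrN2 invf_lt1// ltr1n => /(_ isT).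
    rewrite (_ : 1 - _ = t.+1%:R / t.+2%:R); last first.
      by rewrite -[t.+1%:R](addrK 1) natr1 mulrBl divff ?lt0r_neq0// mul1r.
    by rewrite ln_div ?posrE ?ltr0n// lerNr opprB.
  have := ler_wpM2l (ltW S0) step; rewrite mulrBr.
  by move: (S / _) (S * _) (S * _) IHt => a b c /=; lra.
have upper t : f t.+2 <= ln S - ln t.+1%:R.
  rewrite -ler_expR; apply: le_trans (fexp t.+1) _.
  rewrite expRB !lnK ?posrE ?ltr0n// ler_pM2l// lef_pV2 ?posrE ?ltr0n//.
  by rewrite ler_nat.
have bounded t : (1 - S) * ln t.+1%:R <= ln S - f 2%N.
  by have := lower t; have := upper t; rewrite /=; lra.
rewrite leNgt; apply/negP => S1.
(* If [S < 1], then [bounded] caps every [ln (t + 1)] by [C]; [t = truncn (e^C)] violates this. *)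
pose C := (ln S - f 2%N) / (1 - S).
have := bounded (Num.truncn (expR C)).
apply/negP; rewrite -ltNge mulrC -ltr_pdivrMr ?subr_gt0// -/C.
rewrite -ltr_expR lnK ?posrE ?ltr0n//.
exact: truncnS_gt.
Qed.

Theorem corollary2p2 (R : realType) (u : lattice -> R)
    (hu : forall p : lattice, laplacian u p + expR (u p) = 0) :
  (4%:E <= lattice_integral (fun p => expR (u p)))%E.
Proof.
pose g (q : lattice) := expR (u q).
set M := lattice_integral _.
have M_ge (s : seq lattice) : uniq s -> ((\sum_(q <- s) g q * 4)%:E <= M)%E.
  move=> us; apply: esum_ge; exists [set` s]%classic.
    by split; [exact: finite_seq|].
  by rewrite -fsbig_seq// sumEFin.
have M0 : (0 <= M)%E by have := M_ge [::] isT; rewrite big_nil.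
case ME : M M0 => [r| |] // r0; last by rewrite leey.
(* [r / 4] is the unweighted sum of [e^u], which must be shown to be at least 1. *)
rewrite lee_fin -[4]mul1r -ler_pdivlMr//.
have u_mean : neighbor_mean u = fun q => u q - g q.
  by apply/funext => q; have := hu q; rewrite laplacianE /g; lra.
have g_le t : iter t.+1 neighbor_mean g (0, 0) <= r / 4 / t.+1%:R.
  apply: iter_neighbor_mean_le_sum => [q|s us]; first exact: expR_ge0.
  by rewrite ler_pdivlMr// mulr_suml -lee_fin -ME M_ge.
have u_step t : iter t.+2 neighbor_mean u (0, 0) =
    iter t.+1 neighbor_mean u (0, 0) - iter t.+1 neighbor_mean g (0, 0).
  by rewrite (iterSr t.+1) u_mean iter_neighbor_meanB.
apply: (@ge1_of_harmonic_decay R _ (fun t => iter t neighbor_mean u (0, 0))).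
  by move=> t; rewrite u_step lerD2l lerN2 g_le.
by move=> t; apply: le_trans (expR_iter_neighbor_mean_le _ _ _) (g_le t).
Qed.
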